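(* Both the quasi-order $\to_q$ on finite directed graphs and the quasi-order $\to_q$ on finite undirected graphs are countably universal. That is: (1) for every countable partially ordered set $(P,\le_P)$ there is an injective assignment $p\mapsto G_p$ from $P$ to finite directed graphs such that for all $p,q\in P$, $p\le_P q \iff G_p\to_q G_q$; (2) for every countable partially ordered set $(P,\le_P)$ there is an injective assignment $p\mapsto G_p$ from $P$ to finite undirected graphs such that for all $p,q\in P$, $p\le_P q \iff G_p\to_q G_q$. Consequently, after quotienting by quantum homomorphic equivalence, the corresponding partial orders (on equivalence classes of finite directed graphs, respectively of finite undirected graphs) are countably universal: every countable partially ordered set embeds in each of them as an induced suborder.
   Context: All graphs and digraphs are finite and loopless; undirected graphs are simple; directed graphs have no parallel arcs (a pair of opposite arcs $u\to v$, $v\to u$ is allowed). Quantum homomorphism (undirected). For finite undirected graphs $X,Y$, a quantum homomorphism from $X$ to $Y$ is a family of orthogonal projections $\{E_{x,y}: x\in V(X), y\in V(Y)\}$ on a nonzero finite-dimensional Hilbert space $\mathcal H$ with identity $I$ such that: $\sum_{y\in V(Y)}E_{x,y}=I$ for every $x\in V(X)$; $E_{x,y}E_{x,y'}=0$ whenever $y\ne y'$; and $E_{x,y}E_{x',y'}=0$ whenever $xx'\in E(X)$ and $yy'\notin E(Y)$. Write $X\to_q Y$ if such a family exists. Quantum homomorphism (directed). For directed graphs the definition is the same with the last condition replaced by: $E_{x,y}E_{x',y'}=0$ whenever $(x,x')\in A(X)$ and $(y,y')\notin A(Y)$, where $A(\cdot)$ is the arc set. The relation $\to_q$ is reflexive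 and transitive. Quantum homomorphic equivalence is $G\equiv_q H$ iff $G\to_q H$ and $H\to_q G$; the quotient partial order is the one induced by $\to_q$ on the $\equiv_q$-classes. *)

(* Defs.v *)
From HB Require Import structures.
From mathcomp Require Import all_boot all_order all_algebra.
From mathcomp Require Import all_classical reals.
From mathcomp Require Import complex mxtens spectral.

Set Implicit Arguments.
Unset Strict Implicit.
Unset Printing Implicit Defensive.

Import Order.TTheory GRing.Theory Num.Theory.
Local Open Scope ring_scope.
Local Open Scope complex_scope.
Local Open Scope sesquilinear_scope.

Record digraph := Digraph {
  dvertex :> finType;
  arc : rel dvertex;
  arc_irr : irreflexive arc }.

Record sgraph := SGraph {
  svertex :> finType;
  edge : rel svertex;
  edge_sym : symmetric edge;
  edge_irr : irreflexive edge }.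

Section QuantumHomomorphism.
Variable R : realType.

(* [M ^t*] is the conjugate transpose, i.e. the adjoint for the standard
   inner product of C^n. *)
Definition orthogonal_projection n (P : 'M[R[i]]_n) : Prop :=
  P *m P = P /\ P ^t* = P.

(* The Hilbert space is C^n, and [eX], [eY] are the adjacency relations. *)
Record quantum_hom (X Y : finType) (eX : rel X) (eY : rel Y) (n : nat)
    (E : X -> Y -> 'M[R[i]]_n) : Prop := QuantumHom {
  qhom_proj : forall x y, orthogonal_projection (E x y);
  qhom_sum : forall x, \sum_(y : Y) E x y = 1%:M;
  qhom_orth : forall x y y', y != y' -> E x y *m E x y' = 0;
  qhom_adj : forall x x' y y', eX x x' -> ~~ eY y y' ->
    E x y *m E x' y' = 0 }.

Definition qhom_exists (X Y : finType) (eX : rel X) (eY : rel Y) : Prop :=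
  exists2 n, (0 < n)%N &
    exists E : X -> Y -> 'M[R[i]]_n, quantum_hom eX eY E.

Definition digraph_qhom (G H : digraph) : Prop :=
  qhom_exists (@arc G) (@arc H).

Definition sgraph_qhom (G H : sgraph) : Prop :=
  qhom_exists (@edge G) (@edge H).

Lemma qhom_exists_refl (X : finType) (eX : rel X) : qhom_exists eX eX.
Proof.
exists 1%N => //; exists (fun x y => (x == y)%:R%:M); split.
- move=> x y; split; first by rewrite -scalar_mxM -natrM mulnb andbb.
  by rewrite tr_scalar_mx map_scalar_mx /= rmorph_nat.
- move=> x; rewrite (bigD1 x) //= eqxx big1 ?addr0 // => y.
  by rewrite eq_sym => /negPf->; rewrite raddf0.
- move=> x y y' neq; rewrite -scalar_mxM -natrM mulnb.
  by case: (eqVneq x y) neq => [<- /negPf->|_ _]; rewrite raddf0.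
- move=> x x' y y' exx' neyy'; rewrite -scalar_mxM -natrM mulnb.
  have [xy|_] := eqVneq x y; last by rewrite raddf0.
  have [xy'|_] := eqVneq x' y'; last by rewrite raddf0.
  by rewrite -xy -xy' exx' in neyy'.
Qed.

Lemma tensmx_suml (I : Type) (r : seq I) (Q : pred I) m n p q
    (F : I -> 'M[R[i]]_(m, n)) (B : 'M[R[i]]_(p, q)) :
  (\sum_(k <- r | Q k) F k) *t B = \sum_(k <- r | Q k) F k *t B.
Proof.
apply/matrixP => i j; rewrite !mxE !summxE mulr_suml.
by apply: eq_bigr => k _; rewrite mxE.
Qed.

Lemma tensmx_sumr (I : Type) (r : seq I) (Q : pred I) m n p q
    (A : 'M[R[i]]_(m, n)) (F : I -> 'M[R[i]]_(p, q)) :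
  A *t (\sum_(k <- r | Q k) F k) = \sum_(k <- r | Q k) A *t F k.
Proof.
apply/matrixP => i j; rewrite !mxE !summxE mulr_sumr.
by apply: eq_bigr => k _; rewrite mxE.
Qed.

Lemma qhom_exists_trans (X Y Z : finType)
    (eX : rel X) (eY : rel Y) (eZ : rel Z) :
  qhom_exists eX eY -> qhom_exists eY eZ -> qhom_exists eX eZ.
Proof.
move=> [n n0 [E [Ep Es Eo Ea]]] [m m0 [F [Fp Fs Fo Fa]]].
exists (n * m)%N; first by rewrite muln_gt0 n0.
pose D x z := \sum_(y : Y) E x y *t F y z.
have DD x z x' z' : D x z *m D x' z' =
    \sum_(y : Y) \sum_(y' : Y) (E x y *m E x' y') *t (F y z *m F y' z').
  rewrite mulmx_suml; apply: eq_bigr => y _; rewrite mulmx_sumr.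
  by apply: eq_bigr => y' _; rewrite tensmx_mul.
have Dd x z z' : D x z *m D x z' = \sum_(y : Y) E x y *t (F y z *m F y z').
  rewrite DD; apply: eq_bigr => y _; rewrite (bigD1 y) //= (Ep x y).1.
  rewrite big1 ?addr0 // => y'; rewrite eq_sym => ne.
  by rewrite Eo // tens0mx.
exists D; split.
- move=> x z; split.
    by rewrite Dd; apply: eq_bigr => y _; rewrite (Fp y z).1.
  rewrite /D raddf_sum raddf_sum; apply: eq_bigr => y _ /=.
  by rewrite trmx_tens map_mxT (Ep x y).2 (Fp y z).2.
- move=> x; rewrite exchange_big /=.
  rewrite (eq_bigr (fun y => E x y *t 1%:M)); last first.
    by move=> y _; rewrite -tensmx_sumr Fs.
  rewrite -tensmx_suml Es; apply/matrixP => i j.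
  case: (mxtens_indexP i) => i0 i1; case: (mxtens_indexP j) => j0 j1.
  rewrite tensmxE !mxE -natrM mulnb.
  by rewrite (can_eq (@mxtens_indexK _ _)).
- by move=> x z z' ne; rewrite Dd big1 // => y _; rewrite Fo // tensmx0.
- move=> x x' z z' exx' nezz'; rewrite DD big1 // => y _; rewrite big1 // => y' _.
  have [eyy'|neyy'] := boolP (eY y y').
    by rewrite (Fa _ _ _ _ eyy' nezz') tensmx0.
  by rewrite (Ea _ _ _ _ exx' neyy') tens0mx.
Qed.

Lemma digraph_qhom_refl G : digraph_qhom G G.
Proof. exact: qhom_exists_refl. Qed.

Lemma digraph_qhom_trans G H K :
  digraph_qhom G H -> digraph_qhom H K -> digraph_qhom G K.
Proof. exact: qhom_exists_trans. Qed.

Lemma sgraph_qhom_refl G : sgraph_qhom G G.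
Proof. exact: qhom_exists_refl. Qed.

Lemma sgraph_qhom_trans G H K :
  sgraph_qhom G H -> sgraph_qhom H K -> sgraph_qhom G K.
Proof. exact: qhom_exists_trans. Qed.

End QuantumHomomorphism.

Section QuotientOrder.
Variables (T : Type) (r : T -> T -> Prop).

Definition qo_equiv (x y : T) : Prop := r x y /\ r y x.

Definition qo_class : Type := {A : T -> Prop | exists x, A = qo_equiv x}.

Definition class_of (x : T) : qo_class :=
  exist _ (qo_equiv x) (ex_intro _ x erefl).

Definition class_le (A B : qo_class) : Prop :=
  exists x y, [/\ proj1_sig A x, proj1_sig B y & r x y].

Hypotheses (r_refl : forall x, r x x)
           (r_trans : forall x y z, r x y -> r y z -> r x z).

Lemma class_ofP (A : qo_class) : exists x, A = class_of x.
Proof. by case: A => A [x eA]; exists x; apply: eq_exist. Qed.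

Lemma class_of_eq (x y : T) : class_of x = class_of y <-> qo_equiv x y.
Proof.
split=> [xy|[xy yx]].
  have e : qo_equiv x y = qo_equiv y y :=
    congr1 (fun A : qo_class => proj1_sig A y) xy.
  by rewrite e; split.
have e : qo_equiv x = qo_equiv y.
  apply/funext => z; apply/propext; split=> -[h k]; split;
  by [exact: r_trans yx h | exact: r_trans k xy | exact: r_trans xy h |
      exact: r_trans k yx].
exact: eq_exist.
Qed.

Lemma class_le_of (x y : T) : class_le (class_of x) (class_of y) <-> r x y.
Proof.
split=> [[x' [y' [/= [xx' _] [_ y'y] x'y']]]|xy].
  exact: r_trans xx' (r_trans x'y' y'y).
by exists x, y; split.
Qed.

Lemma class_le_refl (A : qo_class) : class_le A A.
Proof. by have [x ->] := class_ofP A; apply/class_le_of. Qed.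

Lemma class_le_anti (A B : qo_class) : class_le A B -> class_le B A -> A = B.
Proof.
have [[x ->] [y ->]] := (class_ofP A, class_ofP B).
by move=> /class_le_of xy /class_le_of yx; apply/class_of_eq.
Qed.

Lemma class_le_trans (A B C : qo_class) :
  class_le A B -> class_le B C -> class_le A C.
Proof.
have [[x ->] [y ->]] := (class_ofP A, class_ofP B); have [z ->] := class_ofP C.
move=> /class_le_of xy /class_le_of yz; apply/class_le_of.
exact: r_trans xy yz.
Qed.

End QuotientOrder.

Definition countably_universal (T : Type) (r : T -> T -> Prop) : Prop :=
  forall (d : Order.disp_t) (P : porderType d), countable [set: P]%classic ->
    exists G : P -> T,
      injective G /\ forall p q : P, (p <= q)%O <-> r (G p) (G q).

(* Main.v *)
Require Import Defs.
From mathcomp Require Import all_boot all_order all_algebra.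
From mathcomp Require Import all_classical reals.
From mathcomp Require Import complex zify ring.

Set Implicit Arguments.
Unset Strict Implicit.
Unset Printing Implicit Defensive.

Import Order.TTheory GRing.Theory Num.Theory.
Local Open Scope ring_scope.
Local Open Scope complex_scope.

(** Order finite sets of positive integers by: [A] is below [B] when every
    member of [A] is a multiple of a member of [B]. Every countable poset
    embeds in this order, by a classical argument: enumerate the poset; an
    element [n] has only finitely many elements above it that come earlier
    in the enumeration, so the product [U n] of primes attached to these is
    defined, and divisibility among the numbers [U n] records exactly the
    relations that point backwards in the enumeration. Sending [n] to the
    set of the [U m] for the earlier [m] below [n] then records all
    relations ([down_code_le]).

    It remains to realize divisibility by quantum homomorphisms. A finite
    set [A] becomes a disjoint union of rings, one of each length [k] in
    [A], where a ring of length [k] is a graph on [Z/k x V], for a fixed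
    finite set [V], invariant under the rotations of [Z/k]. If [l] divides
    [k], reduction modulo [l] is a homomorphism from the ring of length [k]
    to the ring of length [l].

    The converse has to defeat quantum homomorphisms [E]. The point is that
    implications between relations that can be proved with composition and
    intersection alone survive: if [E x y *m E x' y' = 0] whenever [r x x']
    holds in the source and [r y y'] fails in the target, and the same for
    [s], then it holds for [r \o s] (insert [\sum_z E w z = 1] in the
    middle) and for the intersection of [r] and [s]. So, if the edge
    relation generates in this way the rotation [rho] by [s] on the vertices
    of one type [c], then [rho] has this property, and as [rho] is
    functional in both directions it forces [E x y = E (rho x) (rho y)].
    Rotating [k] times around a ring of length [k] gives [E x y = E x (rho^k
    y)], and since [E x y] and [E x y'] are orthogonal for [y != y'], any
    [y] with [E x y != 0] satisfies [rho^k y = y]. Hence the length of the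
    ring of [y] divides [s * k], and divides [k] if it is prime to [s]
    ([shift_dvd]).

    For digraphs, directed cycles do this with [s = 1]: the arc relation is
    itself the rotation. An undirected graph needs enough asymmetry to
    define a direction, without triangles, since composition and
    intersection only generate series-parallel patterns, and these can all
    be mapped to a triangle. The graph [ladder] below has this asymmetry:
    its pentagons distinguish edges, and the generated relation of
    [ladder_word] is a rotation with [s = 4]. *)

(** * Quantum homomorphisms and relations *)

Lemma qhom_exists_of_hom (R : realType) (X Y : finType) (eX : rel X)
    (eY : rel Y) (f : X -> Y) :
  {homo f : x x' / eX x x' >-> eY x x'} -> qhom_exists R eX eY.
Proof.
move=> f_hom; exists 1%N => //; exists (fun x y => (f x == y)%:R%:M); split.
- move=> x y; split; first by rewrite -scalar_mxM -natrM mulnb andbb.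
  by rewrite tr_scalar_mx map_scalar_mx /= rmorph_nat.
- move=> x; rewrite (bigD1 (f x)) //= eqxx big1 ?addr0 // => y.
  by rewrite eq_sym => /negPf->; rewrite raddf0.
- move=> x y y' neq; rewrite -scalar_mxM -natrM mulnb.
  by case: (eqVneq (f x) y) neq => [<- /negPf->|_ _]; rewrite raddf0.
- move=> x x' y y' /f_hom exx' neyy'; rewrite -scalar_mxM -natrM mulnb.
  have [xy|_] := eqVneq (f x) y; last by rewrite raddf0.
  have [xy'|_] := eqVneq (f x') y'; last by rewrite raddf0.
  by rewrite -xy -xy' exx' in neyy'.
Qed.

Section Supports.
Variables (R : realType) (X Y : finType) (n : nat) (E : X -> Y -> 'M[R[i]]_n).

(** The adjacency condition of a quantum homomorphism, with arbitrary
    relations in place of the edge relations: this form is stable under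
    composition and intersection. *)
Definition supports (rX : rel X) (rY : rel Y) : Prop :=
  forall x x' y y', rX x x' -> ~~ rY y y' -> E x y *m E x' y' = 0.

Lemma supports_cap (rX sX tX : rel X) (rY sY tY : rel Y) :
  supports rX rY -> supports sX sY ->
  (forall x x', tX x x' -> rX x x' && sX x x') ->
  (forall y y', rY y y' -> sY y y' -> tY y y') ->
  supports tX tY.
Proof.
move=> hr hs tX_sub tY_sup x x' y y' /tX_sub /andP[rx sx] nty.
have [ry|nry] := boolP (rY y y'); last exact: hr rx nry.
by apply: hs sx _; apply: contra nty; exact: tY_sup.
Qed.

Hypothesis E_sum : forall x, \sum_y E x y = 1%:M.

(** Inserting [\sum_w E z w = 1], for the intermediate point [z] of the
    source, splits the product into terms each of which dies at its first or
    at its second factor. *)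
Lemma supports_comp (rX sX tX : rel X) (rY sY tY : rel Y) :
  supports rX rY -> supports sX sY ->
  (forall x x', tX x x' -> exists2 z, rX x z & sX z x') ->
  (forall y z y', rY y z -> sY z y' -> tY y y') ->
  supports tX tY.
Proof.
move=> hr hs tX_sub tY_sup x x' y y' /tX_sub[z rx sx] nty.
rewrite -[E x y]mulmx1 -(E_sum z) mulmx_sumr mulmx_suml big1 // => w _.
have [ry|nry] := boolP (rY y w); last by rewrite (hr _ _ _ _ rx nry) mul0mx.
rewrite -mulmxA (hs _ _ _ _ sx) ?mulmx0 //.
by apply: contra nty; exact: tY_sup.
Qed.

Lemma supports_dead (rX : rel X) (rY : rel Y) x x' y :
  supports rX rY -> rX x x' -> (forall w, ~~ rY y w) -> E x y = 0.
Proof.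
move=> hr rx dead; rewrite -[E x y]mulmx1 -(E_sum x') mulmx_sumr.
by rewrite big1 // => w _; exact: hr rx (dead w).
Qed.

(** Both projections equal the product [E x y *m E x' y']: expanding [1] as
    [\sum_w E x' w] on the right of the first, only [w = y'] survives, and
    likewise on the left of the second. *)
Lemma supports_functional (rX : rel X) (rY : rel Y) x x' y y' :
  supports rX rY -> rX x x' ->
  (forall w, rY y w -> w = y') -> (forall w, rY w y' -> w = y) ->
  E x y = E x' y'.
Proof.
move=> hr rx uniq_r uniq_l; transitivity (E x y *m E x' y').
  rewrite -[LHS]mulmx1 -(E_sum x') mulmx_sumr (bigD1 y') //= big1 ?addr0 //.
  move=> w ne; apply: hr rx _; apply: contra ne => /uniq_r->; exact: eqxx.
rewrite -[RHS]mul1mx -(E_sum x) mulmx_suml [RHS](bigD1 y) //= big1 ?addr0 //.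
move=> w ne; apply: hr rx _; apply: contra ne => /uniq_l->; exact: eqxx.
Qed.

End Supports.

(** * Rings built from a template *)

Section Templates.
Variable V : finType.

(** A triple [(v, w, d)] stands for the pairs of the form
    [((i, v), (i + d, w))] with integer [i]: a template is a
    translation-invariant relation on an infinite strip of vertices, of which
    the rings are the quotients. *)
Definition template := seq (V * V * int).

Definition tcomp (S T : template) : template :=
  undup [seq (s.1.1, t.1.2, s.2 + t.2) | s <- S,
                                         t <- [seq t <- T | t.1.1 == s.1.2]].

Definition tcap (S T : template) : template := [seq s <- S | s \in T].

Lemma tcompP (S T : template) u w d :
  reflect (exists v a b,
             [/\ (u, v, a) \in S, (v, w, b) \in T & d = a + b])
          ((u, w, d) \in tcomp S T).
Proof.
rewrite mem_undup; apply: (iffP allpairsPdep).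
  move=> [[[u' v] a] [[[v' w'] b] [sS]]] /=.
  rewrite mem_filter /= => /andP[/eqP-> tT] [-> -> ->].
  by exists v, a, b.
move=> [v [a [b [sS tT ->]]]]; exists (u, v, a), (v, w, b).
by split=> //; rewrite mem_filter eqxx.
Qed.

Section Rings.
Variable A : seq nat.

(** The triple [(k, i, v)] is the vertex of type [v] at position [i] on the
    ring of length [k]; the disjoint union has one ring for each [k] in [A]. *)
Definition ring_points : seq (nat * nat * V) :=
  [seq (q, v) | q <- [seq (k, i) | k <- A, i <- iota 0 k], v <- enum V].

Definition ring_vertex : finType := seq_sub ring_points.

Definition len (x : ring_vertex) : nat := (ssval x).1.1.
Definition pos (x : ring_vertex) : nat := (ssval x).1.2.
Definition typ (x : ring_vertex) : V := (ssval x).2.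

Lemma mem_ring_points k i v :
  ((k, i, v) \in ring_points) = (k \in A) && (i < k)%N.
Proof.
apply/allpairsP/andP => [[[q w] [/=]]|[kA ik]].
  move=> /allpairsPdep[k' [i' [kA]]]; rewrite mem_iota => /andP[_ ik] -> _.
  by move=> [-> -> _].
exists ((k, i), v); split=> //; last by rewrite mem_enum.
by apply/allpairsPdep; exists k, i; rewrite mem_iota ik.
Qed.

Lemma len_mem x : len x \in A.
Proof.
case: x => [[[k i] v] h].
by have := h; rewrite [X in is_true X]mem_ring_points => /andP[].
Qed.

Lemma pos_lt x : (pos x < len x)%N.
Proof.
case: x => [[[k i] v] h].
by have := h; rewrite [X in is_true X]mem_ring_points => /andP[].
Qed.

Lemma ring_vertex_eq x y :
  len x = len y -> pos x = pos y -> typ x = typ y -> x = y.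
Proof.
case: x y => [[[k i] v] hx] [[[k' i'] v'] hy]; rewrite /len /pos /typ /=.
by move=> ek ei ev; apply: val_inj; rewrite /= ek ei ev.
Qed.

Lemma ring_vertex_exists k (z : int) v : k \in A -> (0 < k)%N ->
  exists x, [/\ len x = k, typ x = v & (k %| (pos x)%:Z - z)%Z].
Proof.
move=> kA k0; pose i := `|(z %% k)%Z|%N.
have kz0 : (k : int) != 0 by rewrite -lt0n.
have iE : i%:Z = (z %% k)%Z by rewrite gez0_abs ?modz_ge0.
have ik : (i < k)%N by rewrite -ltz_nat iE ltz_pmod.
have h : (k, i, v) \in ring_points by rewrite mem_ring_points kA.
exists (SeqSub h); split=> //.
by rewrite -eqz_mod_dvd /pos /= iE modz_mod.
Qed.

(** The relation that a template induces on the rings, where offsets are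
    only meaningful modulo the length. *)
Definition step (T : template) : rel ring_vertex := fun x y =>
  (len x == len y) &&
  has (fun t => [&& t.1.1 == typ x, t.1.2 == typ y &
                    (len x %| (pos y)%:Z - (pos x)%:Z - t.2)%Z]) T.

Lemma stepP (T : template) x y :
  reflect (len x = len y /\ exists2 d, (typ x, typ y, d) \in T &
             (len x %| (pos y)%:Z - (pos x)%:Z - d)%Z)
          (step T x y).
Proof.
apply: (iffP andP) => [[/eqP exy /hasP[[[v w] d] tT /=]]|[-> [d tT dv]]].
  by move=> /and3P[/eqP<- /eqP<- dv]; split=> //; exists d.
split=> //; apply/hasP; exists (typ x, typ y, d) => //=.
by rewrite !eqxx.
Qed.

Lemma step_tcomp_split (S T : template) x x' :
  step (tcomp S T) x x' -> exists2 z, step S x z & step T z x'.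
Proof.
move=> /stepP[exx' [d /tcompP[v [a [b [sS tT ->]]]] dv]].
have k0 : (0 < len x)%N by exact: leq_ltn_trans (pos_lt x).
have [z [ez tz pz]] := ring_vertex_exists ((pos x)%:Z + a) v (len_mem x) k0.
exists z; apply/stepP; rewrite ez tz; split=> //.
  by exists a => //; rewrite -addrA -opprD.
exists b => //.
rewrite (_ : _ - _ = (pos x')%:Z - (pos x)%:Z - (a + b)
                     - ((pos z)%:Z - ((pos x)%:Z + a))); first exact: rpredB.
by ring.
Qed.

Lemma step_tcomp_join (S T : template) y z y' :
  step S y z -> step T z y' -> step (tcomp S T) y y'.
Proof.
move=> /stepP[eyz [a sS da]] /stepP[ezy' [b tT db]].
apply/stepP; split; first by rewrite eyz.
exists (a + b); first by apply/tcompP; exists (typ z), a, b.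
rewrite -eyz in db.
rewrite (_ : _ - _ = ((pos z)%:Z - (pos y)%:Z - a)
                     + ((pos y')%:Z - (pos z)%:Z - b)); first exact: rpredD.
by ring.
Qed.

Lemma step_tcap_sub (S T : template) x x' :
  step (tcap S T) x x' -> step S x x' && step T x x'.
Proof.
move=> /stepP[exx' [d]]; rewrite mem_filter => /andP[dT dS] dv.
by apply/andP; split; apply/stepP; split=> //; exists d.
Qed.

Definition span_le (h : nat) (T : template) := all (fun t => `|t.2| <= h)%N T.

(** Two offsets that agree modulo the length of a ring are equal when both
    are less than half that length, so intersections can be computed on the
    strip. *)
Lemma step_tcap_sup h (S T : template) y y' :
  all (fun k => h.*2 < k)%N A -> span_le h S -> span_le h T ->
  step S y y' -> step T y y' -> step (tcap S T) y y'.
Proof.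
move=> /allP long /allP hS /allP hT /stepP[e [a aS da]] /stepP[_ [b bT db]].
apply/stepP; split=> //; exists a => //; rewrite mem_filter aS andbT.
suff -> : a = b by [].
have dvd : (len y %| a - b)%Z.
  rewrite (_ : a - b = ((pos y')%:Z - (pos y)%:Z - b)
                       - ((pos y')%:Z - (pos y)%:Z - a)); first exact: rpredB.
  by ring.
apply/eqP; rewrite -subr_eq0 -absz_eq0; apply/negPn/negP => nz.
have := long _ (len_mem y); have := hS _ aS; have := hT _ bT => /=.
have /dvdn_leq : (len y %| `|a - b|)%N by [].
by rewrite lt0n => /(_ nz); lia.
Qed.

Lemma ring_vertex_eq_mod x y :
  len x = len y -> typ x = typ y -> (len x %| (pos x)%:Z - (pos y)%:Z)%Z ->
  x = y.
Proof.
move=> el et; rewrite -eqz_mod_dvd => /eqP ep; apply: ring_vertex_eq => //.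
move: ep; rewrite !modz_small; first by move=> [].
  by rewrite el ltz_nat pos_lt.
by rewrite ltz_nat pos_lt.
Qed.

Lemma step1P c (s : int) x y :
  reflect [/\ len x = len y, typ x = c, typ y = c &
              (len x %| (pos y)%:Z - (pos x)%:Z - s)%Z]
          (step [:: (c, c, s)] x y).
Proof.
apply: (iffP (stepP _ _ _)) => [[e [d]]|[e tx ty dv]].
  by rewrite inE => /eqP[-> -> ->].
by split=> //; exists s; rewrite // tx ty mem_head.
Qed.

End Rings.

Lemma step_reduce A B (T : template) (f : nat -> nat) :
  (forall k, k \in A -> f k \in B) -> (forall k, k \in B -> (0 < k)%N) ->
  (forall k, k \in A -> (f k %| k)%N) ->
  exists F : ring_vertex A -> ring_vertex B,
    {homo F : x y / step T x y >-> step T x y}.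
Proof.
move=> fB B0 fdv.
have /fin_all_exists[F FP] : forall x : ring_vertex A, exists y : ring_vertex B,
    [/\ len y = f (len x), typ y = typ x &
        (f (len x) %| (pos y)%:Z - (pos x)%:Z)%Z].
  move=> x; apply: ring_vertex_exists; first exact/fB/len_mem.
  exact/B0/fB/len_mem.
exists F => x y /stepP[e [d dT dv]]; have [lx tx px] := FP x.
have [ly ty py] := FP y; apply/stepP; rewrite lx ly e; split=> //.
exists d; first by rewrite tx ty.
rewrite -e in py *.
have dv' : (f (len x) %| (pos y)%:Z - (pos x)%:Z - d)%Z.
  by apply: dvdz_trans dv; apply: fdv; exact: len_mem.
rewrite (_ : _ - _ = ((pos (F y))%:Z - (pos y)%:Z)
                     - ((pos (F x))%:Z - (pos x)%:Z)
                     + ((pos y)%:Z - (pos x)%:Z - d)); last by ring.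
by apply: rpredD => //; exact: rpredB.
Qed.

End Templates.

(** * Quantum homomorphisms between rings *)

Section RingQuantumHom.
Variables (R : realType) (V : finType) (A B : seq nat) (n : nat).
Variable E : ring_vertex V A -> ring_vertex V B -> 'M[R[i]]_n.
Hypothesis E_sum : forall x, \sum_y E x y = 1%:M.

Definition tracks (T : template V) := supports E (step T) (step T).

Lemma tracks_comp S T : tracks S -> tracks T -> tracks (tcomp S T).
Proof.
move=> hS hT; apply: (supports_comp E_sum hS hT).
  exact: step_tcomp_split.
exact: step_tcomp_join.
Qed.

Lemma tracks_cap h S T : all (fun k => h.*2 < k)%N B ->
  span_le h S -> span_le h T -> tracks S -> tracks T -> tracks (tcap S T).
Proof.
move=> long sS sT hS hT; apply: (supports_cap hS hT).
  exact: step_tcap_sub.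
move=> y y'; exact: step_tcap_sup long sS sT.
Qed.

Hypothesis E_orth : forall x y y', y != y' -> E x y *m E x y' = 0.
Hypothesis E_idem : forall x y, E x y *m E x y = E x y.
Hypothesis n_gt0 : (0 < n)%N.

Variables (c : V) (s : nat).
Hypothesis tracks_shift : tracks [:: (c, c, s%:Z)].

Lemma shift_eq x x' y y' :
  step [:: (c, c, s%:Z)] x x' -> step [:: (c, c, s%:Z)] y y' ->
  E x y = E x' y'.
Proof.
move=> xx' yy'; apply: (supports_functional E_sum tracks_shift xx').
  move/step1P: yy' => [e ty ty' dv] w /step1P[ew _ tw dw].
  apply: ring_vertex_eq_mod; rewrite -?ew ?e ?tw ?ty' // -e.
  rewrite (_ : _ - _ = (pos w)%:Z - (pos y)%:Z - s%:Z
                       - ((pos y')%:Z - (pos y)%:Z - s%:Z)); last by ring.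
  exact: rpredB.
move/step1P: yy' => [e ty ty' dv] w /step1P[ew tw _ dw].
apply: ring_vertex_eq_mod; rewrite ?ew ?e ?tw ?ty //.
rewrite e in dv; rewrite ew in dw.
rewrite (_ : _ - _ = (pos y')%:Z - (pos y)%:Z - s%:Z
                       - ((pos y')%:Z - (pos w)%:Z - s%:Z)); last by ring.
exact: rpredB.
Qed.

Lemma shift_iter m x y x' y' :
  typ x = c -> typ y = c -> len x = len x' -> len y = len y' ->
  typ x' = c -> typ y' = c ->
  (len x %| (pos x')%:Z - (pos x)%:Z - s%:Z * m%:Z)%Z ->
  (len y %| (pos y')%:Z - (pos y)%:Z - s%:Z * m%:Z)%Z ->
  E x y = E x' y'.
Proof.
move=> tx ty; elim: m x' y' => [|m IH] x' y' lx ly tx' ty' dx dy.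
  rewrite mulr0 !subr0 in dx dy.
  rewrite (@ring_vertex_eq_mod _ _ x' x) ?tx' // -?lx //.
  by rewrite (@ring_vertex_eq_mod _ _ y' y) ?ty' // -?ly.
have pos0 A' (z : ring_vertex V A') : (0 < len z)%N.
  exact: leq_ltn_trans (pos_lt z).
have [z [lz tz dz]] :=
  ring_vertex_exists ((pos x')%:Z - s%:Z) c (len_mem x') (pos0 _ x').
have [w [lw tw dw]] :=
  ring_vertex_exists ((pos y')%:Z - s%:Z) c (len_mem y') (pos0 _ y').
rewrite (IH z w) ?lz ?lw //.
- apply: shift_eq; apply/step1P; split=> //.
    rewrite lz (_ : _ - _ = - ((pos z)%:Z - ((pos x')%:Z - s%:Z))).
      by rewrite rpredN.
    by ring.
  rewrite lw (_ : _ - _ = - ((pos w)%:Z - ((pos y')%:Z - s%:Z))).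
    by rewrite rpredN.
  by ring.
- rewrite -lx in dz.
  rewrite (_ : _ - _ = (pos z)%:Z - ((pos x')%:Z - s%:Z)
     + ((pos x')%:Z - (pos x)%:Z - s%:Z * m.+1%:Z)); first exact: rpredD.
  by rewrite intS; ring.
- rewrite -ly in dw.
  rewrite (_ : _ - _ = (pos w)%:Z - ((pos y')%:Z - s%:Z)
     + ((pos y')%:Z - (pos y)%:Z - s%:Z * m.+1%:Z)); first exact: rpredD.
  by rewrite intS; ring.
Qed.

(** After [k] shifts [x] is back at its place while [y] has moved to [y'],
    so [E x y = E x y'], which orthogonality allows only if [y' = y]. *)
Lemma shift_dvd k : k \in A -> (0 < k)%N ->
  (forall l, l \in B -> coprime l s) ->
  exists2 l, l \in B & (l %| k)%N.
Proof.
move=> kA k0 cop; have [x [lx tx dx]] := ring_vertex_exists 0 c kA k0.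
have [x' [lx' tx' dx']] := ring_vertex_exists ((pos x)%:Z + s%:Z) c kA k0.
have xx' : step [:: (c, c, s%:Z)] x x'.
  by apply/step1P; rewrite lx lx'; split=> //; rewrite -addrA -opprD.
(* The projections at [x] sum to [1], which is nonzero in positive dimension. *)
have [y Ey] : exists y, E x y != 0.
  apply/existsP; apply: contraTT n_gt0.
  rewrite negb_exists => /forallP none.
  apply/negP => n0.
  have /matrixP/(_ (Ordinal n0) (Ordinal n0)) := E_sum x.
  rewrite big1 => [|z _].
    by rewrite !mxE eqxx => /esym/eqP; rewrite oner_eq0.
  by apply/eqP; have := none z; rewrite negbK.
have ty : typ y = c.
  apply: contraNeq Ey => ty; apply/eqP.
  apply: (supports_dead E_sum tracks_shift xx').
  by move=> w; apply: contra ty => /step1P[_ -> _ _].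
have l0 : (0 < len y)%N by exact: leq_ltn_trans (pos_lt y).
have [y' [ly ty' dy]] :=
  ring_vertex_exists ((pos y)%:Z + s%:Z * k%:Z) c (len_mem y) l0.
have eE : E x y = E x y'.
  apply: (@shift_iter k) => //.
    by rewrite lx subrr sub0r rpredN dvdz_mull.
  by rewrite -addrA -opprD.
have yy' : y' = y.
  apply/eqP; apply: contraNT Ey => ne; rewrite -E_idem {2}eE.
  by apply/eqP/E_orth; rewrite eq_sym.
exists (len y); first exact: len_mem.
rewrite -(@Gauss_dvdr _ s) ?cop ?len_mem //.
by move: dy; rewrite yy' opprD addNKr rpredN.
Qed.

End RingQuantumHom.

(** Derivability of [T] from [S] by composition and intersection, stated
    through its effect on [E] so that it is uniform in the rings; the bound
    [h] on the offsets is what makes the intersections correct on the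
    target. *)
Definition forces (V : finType) (h : nat) (S T : template V) : Prop :=
  forall (R : realType) (A B : seq nat) (n : nat)
    (E : ring_vertex V A -> ring_vertex V B -> 'M[R[i]]_n),
    (forall x, \sum_y E x y = 1%:M) -> all (fun k => h.*2 < k)%N B ->
    tracks E S -> tracks E T.

Section Forces.
Variables (V : finType) (h : nat) (S : template V).

Lemma forces_refl : forces h S S.
Proof. by []. Qed.

Lemma forces_comp T U : forces h S T -> forces h S U -> forces h S (tcomp T U).
Proof.
move=> hT hU R A B n E E_sum long hS.
by apply: tracks_comp => //; [exact: hT | exact: hU].
Qed.

Lemma forces_cap T U : span_le h T -> span_le h U ->
  forces h S T -> forces h S U -> forces h S (tcap T U).
Proof.
move=> sT sU hT hU R A B n E E_sum long hS.
by apply: (tracks_cap long sT sU); [exact: hT | exact: hU].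
Qed.

Lemma ring_qhomP (R : realType) (c : V) (s : nat) (A B : seq nat) :
  forces h S [:: (c, c, s%:Z)] ->
  all (fun k => h.*2 < k)%N A -> all (fun k => h.*2 < k)%N B ->
  {in B, forall l, coprime l s} ->
  qhom_exists R (@step V A S) (@step V B S) <->
  forall k, k \in A -> exists2 l, l \in B & (l %| k)%N.
Proof.
move=> hS longA longB cop.
have pos_of C : all (fun k => h.*2 < k)%N C -> forall k, k \in C -> (0 < k)%N.
  by move=> /allP long k /long; exact: leq_ltn_trans.
split=> [[n n0 [E [E_proj E_sum E_orth E_adj]]] k kA | dvd].
  apply: (@shift_dvd R V A B n E E_sum E_orth _ n0 c s) => //.
  - by move=> x y; have [] := E_proj x y.
  - exact: hS.
  - exact: pos_of longA _ kA.
pose f k := nth 0%N B (find (fun l => l %| k)%N B).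
have has_f k : k \in A -> has (fun l => l %| k)%N B.
  by move=> /dvd[l lB lk]; apply/hasP; exists l.
have fB k : k \in A -> f k \in B.
  by move=> kA; apply: mem_nth; rewrite -has_find has_f.
have f_dvd k : k \in A -> (f k %| k)%N by move=> /has_f/(nth_find 0%N).
have [F F_hom] := step_reduce S fB (pos_of B longB) f_dvd.
exact: qhom_exists_of_hom F_hom.
Qed.

End Forces.

(** * The two templates *)

Section StepGraphs.
Variables (V : finType) (h : nat) (T : template V).
Hypothesis T_span : span_le h T.
Hypothesis T_irr : all (fun t => (t.1.1 == t.1.2) ==> (t.2 != 0)) T.

Lemma step_irr A : all (fun k => h.*2 < k)%N A -> irreflexive (@step V A T).
Proof.
move=> /allP long x; apply/negbTE/stepP => -[_ [d dT dv]].
have /= := allP T_irr _ dT; rewrite eqxx -absz_eq0 -lt0n /= => d0.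
have /= hd := allP T_span _ dT; have := long _ (len_mem x).
move: dv; rewrite subrr sub0r rpredN => dv.
by have := dvdn_leq d0 dv; lia.
Qed.

Lemma step_sym A : all (fun t => (t.1.2, t.1.1, - t.2) \in T) T ->
  symmetric (@step V A T).
Proof.
move=> /allP T_sym.
have sub x y : step T x y -> step T y x.
  move=> /stepP[e [d dT dv]]; apply/stepP; split=> //.
  exists (- d); first exact: T_sym dT.
  rewrite -e (_ : _ - _ = - ((pos y)%:Z - (pos x)%:Z - d)); last by ring.
  by rewrite rpredN.
by move=> x y; apply/idP/idP; exact: sub.
Qed.

End StepGraphs.

Definition cycle_template : template unit := [:: (tt, tt, 1)].

Definition cycle_digraph (A : seq nat) (long : all (fun k => 12.*2 < k)%N A) :
    digraph :=
  Digraph (@step_irr unit 12 cycle_template isT isT A long).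

Definition cap : option bool := None.
Definition rail (b : bool) : option bool := Some b.

(** Vertices [c_i] of type [rail true], [b_i] of type [rail false] and [a_i]
    of type [cap]. The two rails [b] and [c] form an infinite ladder, and
    [a_i] is joined to [c_(i-2)], [c_(i+2)] and [b_(i+4)]. The path [c_(i+2)
    a_i b_(i+4)] closes to a pentagon with each of the three shortest paths
    of the ladder from [c_(i+2)] to [b_(i+4)], whereas the edge [a_i
    c_(i-2)] lies on no pentagon. This breaks the symmetry between the two
    directions of the strip. *)
Definition ladder_half : template (option bool) :=
  [:: (rail true, rail true, 1); (rail false, rail false, 1);
      (rail true, rail false, 0);
      (cap, rail true, - 2%:Z); (cap, rail true, 2%:Z);
      (cap, rail false, 4%:Z)].

Definition ladder : template (option bool) :=
  ladder_half ++ [seq (t.1.2, t.1.1, - t.2) | t <- ladder_half].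

Definition ladder_graph (A : seq nat) (long : all (fun k => 12.*2 < k)%N A) :
    sgraph :=
  SGraph (@step_sym _ ladder A isT)
         (@step_irr _ 12 ladder isT isT A long).

Definition ladder2 := tcomp ladder ladder.
Definition ladder3 := tcomp ladder2 ladder.
Definition ladder4 := tcomp ladder3 ladder.
(** As there are no triangles, an edge whose ends are also joined by a walk
    of length 4 lies on a pentagon, and a pair joined by walks of lengths 2
    and 3 is a diagonal of a pentagon. *)
Definition pentagon_edge := tcap ladder ladder4.
Definition pentagon_diag := tcap ladder2 ladder3.
Definition diag2 := tcomp pentagon_diag pentagon_diag.
Definition diag3 := tcomp diag2 pentagon_diag.

Lemma ladder_spans :
  all (span_le 12) [:: ladder; ladder2; ladder3; ladder4; diag2; diag3;
                       tcomp ladder pentagon_edge;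
                       tcap (tcomp ladder pentagon_edge) diag2].
Proof. by vm_compute. Qed.

(** Among the pairs joined by an edge followed by a pentagon edge is the
    pair [(c_i, c_(i+4))], through [a_(i+2)]. It is the only one of them, up
    to translation, that is also joined by two and by three pentagon diagonals;
    the reverse pair is absent because its second edge would be [a_(i+2)
    c_i], which lies on no pentagon. *)
Lemma ladder_word :
  tcap (tcap (tcomp ladder pentagon_edge) diag2) diag3 =
  [:: (rail true, rail true, 4%:Z)].
Proof. by apply/eqP; vm_compute. Qed.

Lemma ladder_forces : forces 12 ladder [:: (rail true, rail true, 4%:Z)].
Proof.
have /and5P[s1 s2 s3 s4 /and5P[sd2 sd3 sT sTd _]] := ladder_spans.
have L1 := @forces_refl _ 12 ladder.
have L2 : forces 12 ladder ladder2 := forces_comp L1 L1.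
have L3 : forces 12 ladder ladder3 := forces_comp L2 L1.
have L4 : forces 12 ladder ladder4 := forces_comp L3 L1.
have edge : forces 12 ladder pentagon_edge := forces_cap s1 s4 L1 L4.
have diag : forces 12 ladder pentagon_diag := forces_cap s2 s3 L2 L3.
have D2 : forces 12 ladder diag2 := forces_comp diag diag.
have D3 : forces 12 ladder diag3 := forces_comp D2 diag.
rewrite -ladder_word; apply: (forces_cap sTd sd3 _ D3).
exact: (forces_cap sT sd2 (forces_comp L1 edge) D2).
Qed.

Lemma cycle_forces : forces 12 cycle_template [:: (tt, tt, 1%:Z)].
Proof. exact: forces_refl. Qed.

(** * Countable posets and divisibility *)

Section DivisibilityOrder.
Local Open Scope nat_scope.

(** The primes exceed [24 = 2 * 12], since rings must be longer than twice
    the bound [12] on the offsets in [ladder_forces], and so they are odd,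
    hence prime to the shift [4] of [ladder_word]. *)
Fixpoint big_prime (j : nat) : nat :=
  sval (prime_above (if j is j'.+1 then big_prime j' else 24)).

Lemma big_prime_prime j : prime (big_prime j).
Proof. by case: j => [|j] /=; case: prime_above. Qed.

Lemma big_prime_ltS j : big_prime j < big_prime j.+1.
Proof. by rewrite /=; case: (prime_above (big_prime j)). Qed.

Lemma big_prime_gt j : 24 < big_prime j.
Proof.
elim: j => [|j IH]; first by rewrite /=; case: prime_above.
exact: ltn_trans (big_prime_ltS j).
Qed.

Lemma big_prime_inj : injective big_prime.
Proof.
apply/incn_inj/leq_mono; apply: homo_ltn big_prime_ltS.
exact: ltn_trans.
Qed.

Variable le : rel nat.
Hypothesis le_trans : transitive le.
(** Reflexivity is only asked on the domain of [le]: its indices are the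
    codes of the elements of a poset, which need not exhaust [nat]. *)
Hypothesis le_dom : forall m n, le m n -> le m m && le n n.

Definition older_above n : nat := \prod_(r < n.+1 | le n r) big_prime r.

Definition down_code n : seq nat :=
  [seq older_above m | m <- iota 0 n.+1 & le m n].

Lemma dvd_older_above m n : m <= n -> le n m -> big_prime m %| older_above n.
Proof.
rewrite -ltnS => mn nm; rewrite /older_above.
by rewrite (bigD1 (Ordinal mn)) //= dvdn_mulr.
Qed.

Lemma older_above_dvd m n : big_prime m %| older_above n -> le n m.
Proof.
rewrite /older_above Euclid_dvd_prod ?big_prime_prime // big_has_cond.
move=> /hasP[r _ /= /andP[nr]].
by rewrite dvdn_prime2 ?big_prime_prime // => /eqP/big_prime_inj->.
Qed.

Lemma older_above_mono m n : n <= m -> le m n -> older_above n %| older_above m.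
Proof.
move=> nm le_mn; rewrite /older_above.
rewrite (big_ord_widen_cond m.+1 (le n) big_prime) ?ltnS //.
rewrite [X in _ %| X](bigID (fun r : 'I_m.+1 => le n r && (r < n.+1))) /=.
rewrite [X in _ %| X * _](eq_bigl (fun r : 'I_m.+1 => le n r && (r < n.+1))).
  exact: dvdn_mulr.
move=> r /=; case: (boolP (le n r)) => [nr|]; last by rewrite andbF.
by rewrite (le_trans le_mn nr).
Qed.

Lemma older_above_gt n : le n n -> 24 < older_above n.
Proof.
move=> nn; apply: leq_trans (big_prime_gt n) _.
apply: dvdn_leq (dvd_older_above (leqnn n) nn).
by apply: prodn_gt0 => r; exact: ltn_trans (big_prime_gt r).
Qed.

Lemma coprime_older_above n : coprime (older_above n) 4.
Proof.
apply: (big_ind (coprime^~ 4)) => // [a b|r _].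
  by rewrite coprimeMl => -> ->.
rewrite (@coprimeXr 2 _ 2) // prime_coprime ?big_prime_prime //.
rewrite dvdn_prime2 ?big_prime_prime // neq_ltn.
by rewrite (leq_trans _ (big_prime_gt r)) ?orbT.
Qed.

Lemma down_codeP k n :
  reflect (exists m, [/\ m <= n, le m n & k = older_above m])
          (k \in down_code n).
Proof.
apply: (iffP mapP) => [[m]|[m [mn le_mn ->]]].
  by rewrite mem_filter mem_iota ltnS => /and3P[? _ ?] ->; exists m.
by exists m => //; rewrite mem_filter le_mn mem_iota ltnS.
Qed.

(** If [le i j], a member [older_above m] of the code of [i] is either
    itself a member of the code of [j], when [m <= j], or a multiple of
    [older_above j], when [j] precedes [m]. Conversely, if [older_above m]
    with [le m j] divides [older_above i], then so does the prime of [m],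
    whence [le i m]. *)
Lemma down_code_le i j : le i i -> le j j ->
  le i j <-> (forall k, k \in down_code i ->
                exists2 l, l \in down_code j & l %| k).
Proof.
move=> ii jj; split=> [ij k /down_codeP[m [mi le_mi ->]]|dom].
  have le_mj : le m j by exact: le_trans le_mi ij.
  have [mj|/ltnW jm] := leqP m j.
    by exists (older_above m) => //; apply/down_codeP; exists m.
  exists (older_above j); first by apply/down_codeP; exists j.
  exact: older_above_mono.
have [|_ /down_codeP[m [_ le_mj ->]] dvd] := dom (older_above i).
  by apply/down_codeP; exists i.
apply: (le_trans _ le_mj); apply: older_above_dvd; apply: dvdn_trans dvd.
by apply: dvd_older_above => //; have /andP[] := le_dom le_mj.
Qed.

End DivisibilityOrder.

Lemma divisibility_universal d (P : porderType d) :
  countable [set: P]%classic ->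
  exists A : P -> seq nat,
    [/\ forall p, all (fun k => 12.*2 < k)%N (A p),
        forall p, {in A p, forall k, coprime k 4} &
        forall p q, (p <= q)%O <->
          forall k, k \in A p -> exists2 l, l \in A q & (l %| k)%N].
Proof.
move=> /countable_injP[code code_inj'].
have code_inj : injective code by move=> p q; apply: code_inj'; rewrite inE.
pose le m n := `[< exists p q, [/\ code p = m, code q = n & (p <= q)%O] >].
have leE p q : le (code p) (code q) = (p <= q)%O.
  apply/asboolP/idP => [[p' [q' [/code_inj-> /code_inj->]]]|pq] //.
  by exists p, q.
have le_in m n : le m n -> exists p q, code p = m /\ code q = n.
  by move=> /asboolP[p [q [<- <- _]]]; exists p, q.
have le_dom m n : le m n -> le m m && le n n.
  by move=> /le_in[p [q [<- <-]]]; rewrite !leE !lexx.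
have transitive_le : transitive le.
  move=> n m r /[dup] /le_in[p [q [<- <-]]] pq.
  move=> /asboolP[q' [s [/code_inj eq <- qs]]].
  by move: pq; rewrite !leE => /le_trans; apply; rewrite -eq.
exists (fun p => down_code le (code p)); split=> [p|p k|p q].
- apply/allP => k /down_codeP[m [_ le_mp ->]].
  by apply: older_above_gt; have /andP[] := le_dom _ _ le_mp.
- by move=> /down_codeP[m [_ _ ->]]; exact: coprime_older_above.
- by rewrite -leE; apply: down_code_le; rewrite ?leE.
Qed.

(** Injectivity comes for free: elements with the same graph are below each
    other, by reflexivity of [r]. *)
Lemma universal_of_codes (T : Type) (r : T -> T -> Prop)
    (G : forall A : seq nat, all (fun k => 12.*2 < k)%N A -> T) :
  (forall x, r x x) ->
  (forall A B longA longB, {in B, forall l, coprime l 4} ->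
     r (G A longA) (G B longB) <->
     forall k, k \in A -> exists2 l, l \in B & (l %| k)%N) ->
  countably_universal r.
Proof.
move=> r_refl rG d P /divisibility_universal[A [long cop A_le]].
have le_r p q : (p <= q)%O <-> r (G _ (long p)) (G _ (long q)).
  by rewrite A_le rG.
exists (fun p => G _ (long p)); split=> // p q eq_pq.
by apply/le_anti/andP; split; apply/le_r; rewrite eq_pq.
Qed.

Lemma class_universal (T : Type) (r : T -> T -> Prop) :
  (forall x, r x x) -> (forall x y z, r x y -> r y z -> r x z) ->
  countably_universal r -> countably_universal (@class_le _ r).
Proof.
move=> r_refl r_trans univ d P /univ[G [_ le_r]].
have le_class p q :
    (p <= q)%O <-> class_le (@class_of _ r (G p)) (@class_of _ r (G q)).
  by rewrite (class_le_of r_refl r_trans).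
exists (fun p => @class_of _ r (G p)); split=> // p q eq_pq.
apply/le_anti/andP; split; apply/le_class; rewrite eq_pq; exact: class_le_refl.
Qed.

Theorem theorem1p1 (R : realType) :
  [/\ countably_universal (@digraph_qhom R),
      countably_universal (@sgraph_qhom R),
      countably_universal (@class_le _ (@digraph_qhom R)) &
      countably_universal (@class_le _ (@sgraph_qhom R))].
Proof.
have digraphs : countably_universal (@digraph_qhom R).
  apply: (@universal_of_codes _ _ cycle_digraph) => [|A B longA longB _].
    exact: digraph_qhom_refl.
  by apply: (ring_qhomP R cycle_forces) => // l _; exact: coprimen1.
have graphs : countably_universal (@sgraph_qhom R).
  apply: (@universal_of_codes _ _ ladder_graph) => [|A B longA longB coprime_B].
    exact: sgraph_qhom_refl.
  exact: (ring_qhomP R ladder_forces).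
split=> //; apply: class_universal => //.
- exact: digraph_qhom_refl.
- exact: digraph_qhom_trans.
- exact: sgraph_qhom_refl.
- exact: sgraph_qhom_trans.
Qed.
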